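(* Let $n\ge 2$ and consider an equation $\sum_{i,j=1}^n f_{ij}({\bf p})u_{x_ix_j}=0$ for $u(x_1,\dots,x_n)$, where $(f_{ij})$ is a symmetric nondegenerate matrix of functions of ${\bf p}=(p^1,\dots,p^n)$, $p^i=u_{x_i}$. The following are equivalent: (1) the equation is linearizable by a transformation from the equivalence group $SL(n+1,\mathbb{R})$; (2) the equation is Lagrangian with Lagrangian density $g=Q({\bf p})/l({\bf p})$, where $Q$ is a (not necessarily homogeneous) quadratic polynomial and $l$ a (not necessarily homogeneous) linear polynomial in $p^1,\dots,p^n$; (3) the conformal structure $f_{ij}dp^idp^j$ possesses a complex (a $(2n-3)$-parameter family) of null lines whose quadratic cones all pass through a fixed quadric contained in a fixed hyperplane. For $n=3$ these conditions are equivalent to the requirement that the null lines form a quadratic line complex with Segre symbol $[(222)]$.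
   Context: The equivalence group consists of the transformations $\tilde{\bf x}=C{\bf x}+bu$, $\tilde u=c{\bf x}+\beta u$ (with $C$ an $n\times n$ matrix, $b$ a column vector, $c$ a row vector, $\beta$ a scalar, the whole $(n+1)\times(n+1)$ matrix in $SL(n+1,\mathbb{R})$); they act on ${\bf p}$ (a row vector) projectively by $\tilde{\bf p}=\kappa{\bf p}C^{-1}+cC^{-1}$, $\kappa=1/\det(C+b{\bf p})$, and on the coefficient matrix $F=(f_{ij})$ by $\tilde F=\kappa^{-1}(C+b{\bf p})F(C+b{\bf p})^t$. Thus ${\bf p}$ are affine coordinates on projective space $P^n$ and $f_{ij}dp^idp^j$ is a conformal structure on it (the equation is considered up to a nonzero factor). Linearizable means the transformed coefficient matrix is proportional to a constant matrix. Lagrangian with density $g({\bf p})$ means $(f_{ij})$ is proportional to the Hessian matrix $(\partial^2 g/\partial p^i\partial p^j)$, i.e. the equation is the Euler–Lagrange equation of $\int g(\nabla u)\,d{\bf x}$. A null line is a straight line in $P^n$ whose tangent direction is null for $f_{ij}dp^idp^j$ at each of its points; for a complex of null lines, the lines through a point form the null cone at that point. *)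

(* Defs.v *)
From HB Require Import structures.
From mathcomp Require Import all_boot all_order all_algebra.
From mathcomp Require Import all_classical all_reals all_analysis.
From mathcomp Require Import complex.

Set Implicit Arguments.
Unset Strict Implicit.
Unset Printing Implicit Defensive.

Import Order.TTheory GRing.Theory Num.Theory.
Local Open Scope ring_scope.
Local Open Scope classical_set_scope.

Definition cx {R : realType} (x : R) : R[i] := Complex x 0.

Definition cqf {R : realType} {m : nat} (A : 'M[R]_m) (v : 'rV[R[i]]_m)
  : R[i] := (v *m map_mx cx A *m v^T) 0 0.

(* Homogeneous coordinates: the point p of the affine chart of P^n is
   (p, 1); a direction v is the point at infinity (v, 0). *)
Definition hpt {R : realType} {n : nat} (p : 'rV[R]_n) : 'rV[R[i]]_(n + 1) :=
  map_mx cx (row_mx p 1).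
Definition hdir {R : realType} {n : nat} (v : 'rV[R[i]]_n) : 'rV[R[i]]_(n + 1) :=
  row_mx v 0.

Definition null_dir {R : realType} {n : nat} (F : 'rV[R]_n -> 'M[R]_n)
  (p : 'rV[R]_n) (v : 'rV[R[i]]_n) : Prop := cqf (F p) v = 0.

Definition hessian {R : realType} {n : nat} (g : 'rV[R]_n -> R)
  (p : 'rV[R]_n) : 'M[R]_n :=
  \matrix_(i < n, j < n)
     derive (fun q => derive g q (delta_mx 0 i)) p (delta_mx 0 j).

(* (1) Linearizability by an element M = [[C, b], [c, beta]] of
   SL(n+1,R): the transformed coefficient matrix
   kappa^-1 (C + b p) F (C + b p)^t, kappa = 1/det(C + b p),
   is (at every point of U, where the transformation is defined)
   proportional to one fixed constant matrix A.  (Since the factor of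
   proportionality is an arbitrary function, it does not matter whether
   the transformed matrix is regarded as a function of p or of the new
   variable p~ = kappa p C^-1 + c C^-1.) *)
Definition linearizable {R : realType} {n : nat} (U : set 'rV[R]_n)
  (F : 'rV[R]_n -> 'M[R]_n) : Prop :=
  exists M : 'M[R]_(n + 1), \det M = 1 /\
    exists A : 'M[R]_n, forall p, U p ->
      let C := ulsubmx M in
      let b := ursubmx M in
      let Cbp := C + b *m p in
      \det Cbp != 0 /\
      exists lam : R, \det Cbp *: (Cbp *m F p *m Cbp^T) = lam *: A.

Definition quad_poly {R : realType} {n : nat} (A : 'M[R]_n) (B : 'rV[R]_n)
  (c0 : R) (p : 'rV[R]_n) : R := (p *m A *m p^T) 0 0 + (B *m p^T) 0 0 + c0.
Definition lin_poly {R : realType} {n : nat} (a : 'rV[R]_n) (a0 : R)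
  (p : 'rV[R]_n) : R := (a *m p^T) 0 0 + a0.

Definition lagrangian_QL {R : realType} {n : nat} (U : set 'rV[R]_n)
  (F : 'rV[R]_n -> 'M[R]_n) : Prop :=
  exists (A : 'M[R]_n) (B a : 'rV[R]_n) (c0 a0 : R),
    (forall p, U p -> lin_poly a a0 p != 0) /\
    forall p, U p -> exists lam : R,
      F p = lam *: hessian (fun q => quad_poly A B c0 q / lin_poly a a0 q) p.

(* The line through the point p with (complex) direction v meets the quadric
   S = {X in H | X Qh X^t = 0} lying in the hyperplane H = {X | X L^t = 0}
   (homogeneous coordinates).  The intersection point of the line with H
   is  L(P) V - L(V) P. *)
Definition line_meets_quadric {R : realType} {n : nat}
  (L : 'rV[R]_(n + 1)) (Qh : 'M[R]_(n + 1))
  (p : 'rV[R]_n) (v : 'rV[R[i]]_n) : Prop :=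
  let lin (X : 'rV[R[i]]_(n + 1)) := (X *m (map_mx cx L)^T) 0 0 in
  let P := hpt p in
  let V := hdir v in
  cqf Qh (lin P *: V - lin V *: P) = 0.

(* (3) The null lines contain the complex of all lines meeting a fixed
   quadric S in a fixed hyperplane H, and the lines of that complex through
   each point p of U form exactly the null cone at p (equivalently: the
   null cone at every p is the cone with vertex p over S). *)
Definition null_complex_through_quadric {R : realType} {n : nat}
  (U : set 'rV[R]_n) (F : 'rV[R]_n -> 'M[R]_n) : Prop :=
  exists (L : 'rV[R]_(n + 1)) (Qh : 'M[R]_(n + 1)),
    L != 0 /\
    forall p, U p ->
      (row_mx p 1 *m L^T) 0 0 != 0 /\
      forall v : 'rV[R[i]]_n, null_dir F p v <-> line_meets_quadric L Qh p v.

(* Plücker coordinates (pi_01, pi_02, pi_03, pi_12, pi_13, pi_23) of the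
   line through the points X, Y of P^3: pi_ij = X_i Y_j - X_j Y_i. *)
Definition pl_i (k : 'I_6) : 'I_4 := inord (nth 0%N [:: 0; 0; 0; 1; 1; 2]%N k).
Definition pl_j (k : 'I_6) : 'I_4 := inord (nth 0%N [:: 1; 2; 3; 2; 3; 3]%N k).
Definition plucker {K : pzRingType} (X Y : 'rV[K]_4) : 'rV[K]_6 :=
  \row_(k < 6) (X 0 (pl_i k) * Y 0 (pl_j k) - X 0 (pl_j k) * Y 0 (pl_i k)).

(* Matrix of the Klein quadric pi_01 pi_23 - pi_02 pi_13 + pi_03 pi_12
   (up to the irrelevant factor 2); it is its own inverse. *)
Definition klein {R : realType} : 'M[R]_6 :=
  \matrix_(k < 6, l < 6)
    (if (k + l == 5)%N then (if (k == 1%N :> nat) || (k == 4%N :> nat) then -1 else 1)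
     else 0).

(* The quadratic line complex {pi | pi Cq pi^t = 0} (Cq symmetric) has
   Segre symbol [(222)]: the pencil Cq - lambda*Klein has a single
   eigenvalue mu (i.e. Klein^-1 Cq has the single eigenvalue mu) with three
   Jordan blocks of size 2: N := Klein^-1 Cq - mu I satisfies N^2 = 0 and
   rank N = 3. *)
Definition segre_222 {R : realType} (Cq : 'M[R]_6) : Prop :=
  Cq^T = Cq /\
  exists mu : R, let N := klein *m Cq - mu%:M in N *m N = 0 /\ \rank N = 3%N.

Definition null_quadratic_complex_222 {R : realType} (U : set 'rV[R]_3)
  (F : 'rV[R]_3 -> 'M[R]_3) : Prop :=
  exists Cq : 'M[R]_6, segre_222 Cq /\
    forall p, U p -> forall v : 'rV[R[i]]_3,
      null_dir F p v <-> cqf Cq (plucker (hpt p) (hdir v)) = 0.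

(* Main.v *)
Require Import Defs.
From HB Require Import structures.
From mathcomp Require Import all_boot all_order all_algebra.
From mathcomp Require Import all_classical all_reals all_analysis.
From mathcomp Require Import complex.
From mathcomp Require Import ring.
Import numFieldNormedType.Exports.
Import Order.TTheory GRing.Theory Num.Theory.
Local Open Scope ring_scope.
Local Open Scope classical_set_scope.

Set Implicit Arguments.
Unset Strict Implicit.
Unset Printing Implicit Defensive.

(* All conditions are equivalent to the following one: there are a hyperplane
   L and a quadratic form Q such that, at every p in U, L(P) <> 0 for P = (p, 1)
   and F(p) is proportional to v |-> Q(L(P) V - L(V) P), V = (v, 0).

   Lagrangians: this form is, up to the factor L(P)^3, the Hessian of the
   quotient Q(P) / L(P).
   Linearizability: if the rows of [C, -b] span the hyperplane L, then
   v = w (C + b p) turns L(P) V - L(V) P into L(P) w [C, -b], so that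
   (C + b p) F (C + b p)^t is proportional to the restriction of Q to L.
   Null lines: two complex quadratic forms with the same zeros, one of them
   nonzero, are proportional.
   Segre symbol: modulo the Klein form the complex is given by a form whose
   row space W is isotropic of dimension 3.  Nondegeneracy of F at one point p0
   says that W is a complement to the plane of lines through p0, which excludes
   one of the two families of isotropic 3-spaces, so W = { L /\ m } for a
   covector L, and the form factors through the contraction of bivectors with L. *)

(** * Roots of quadratic polynomials in one variable *)

Section ZeroSets.
Variable K : fieldType.

(** The zero set determines the multiplicities: a single common zero is a double root on both sides,
    and two distinct zeros are the two roots of each polynomial. *)
Lemma quadratic_same_roots (a a' r1 r2 s1 s2 : K) : a != 0 -> a' != 0 ->
  (forall t, a * (t - r1) * (t - r2) = 0 <-> a' * (t - s1) * (t - s2) = 0) ->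
  r1 * r2 = s1 * s2.
Proof.
move=> a0 a'0 h.
have {}h t : ((t == r1) || (t == r2)) = ((t == s1) || (t == s2)).
  apply/idP/idP.
    move=> ht; have /h/eqP : a * (t - r1) * (t - r2) = 0.
      by case/orP: ht => /eqP->; rewrite subrr ?mulr0 ?mul0r.
    by rewrite !mulf_eq0 (negPf a'0) /= !subr_eq0.
  move=> ht; have /h/eqP : a' * (t - s1) * (t - s2) = 0.
    by case/orP: ht => /eqP->; rewrite subrr ?mulr0 ?mul0r.
  by rewrite !mulf_eq0 (negPf a0) /= !subr_eq0.
have := h r1; have := h r2; have := h s1; have := h s2.
rewrite !eqxx /= !orbT /= => e1 e2 /esym e3 /esym e4.
by case/orP: e1 => /eqP e1; case/orP: e2 => /eqP e2; case/orP: e3 => /eqP e3;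
  case/orP: e4 => /eqP e4; subst; rewrite // mulrC.
Qed.

End ZeroSets.

(** * Quadratic forms with real matrices at complex vectors *)

Section QuadraticForms.
Variable R : realType.

Lemma complex_quadratic_split (a b c : R[i]) : a != 0 ->
  exists r s, c = a * (r * s) /\
    forall t, c + b * t + a * t ^+ 2 = a * (t - r) * (t - s).
Proof.
move=> a0; set d := sqrtc (b ^+ 2 - 4 * a * c).
have two0 : (2 : R[i]) != 0 by rewrite pnatr_eq0.
have dd : d ^+ 2 = b ^+ 2 - 4 * a * c by rewrite sqr_sqrtc.
pose r := (- b + d) / (2 * a); pose s := (- b - d) / (2 * a).
have e1 : c = a * (r * s).
  have -> : a * (r * s) = (b ^+ 2 - d ^+ 2) / (4 * a) by rewrite /r /s; field.
  by rewrite dd; field.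
have e2 : b = - a * (r + s) by rewrite /r /s; field.
by exists r, s; split => // t; rewrite {1}e1 {1}e2; ring.
Qed.

(** By Vieta, c / a and c' / a' are the products of the roots. Only constant terms are compared: on
    a line u + t w they are the values of the forms at u. *)
Lemma proportional_of_same_zeros (a b c a' b' c' : R[i]) : a != 0 -> a' != 0 ->
  (forall t, c + b * t + a * t ^+ 2 = 0 <-> c' + b' * t + a' * t ^+ 2 = 0) ->
  a' * c = a * c'.
Proof.
move=> a0 a'0.
have [r [s [ec es]]] := complex_quadratic_split b c a0.
have [r' [s' [ec' es']]] := complex_quadratic_split b' c' a'0.
move=> h; rewrite ec ec' mulrCA; congr (_ * (_ * _)).
by apply: (@quadratic_same_roots _ a a') => // t; rewrite -es -es'.
Qed.

Lemma cqf_line (n : nat) (A : 'M[R]_n) (u w : 'rV[R]_n) (t : R[i]) :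
  cqf A (map_mx cx u + t *: map_mx cx w) =
  cx ((u *m A *m u^T) 0 0) + cx ((u *m A *m w^T + w *m A *m u^T) 0 0) * t
    + cx ((w *m A *m w^T) 0 0) * t ^+ 2.
Proof.
rewrite /cqf linearD /= linearZ /= !mulmxDl !mulmxDr -!scalemxAl -!scalemxAr !map_trmx.
rewrite -!(map_mxM (real_complex R)) !scalerA.
have cxD x y : cx (x + y) = cx x + cx y := rmorphD (real_complex R) x y.
rewrite [(u *m A *m w^T + _) 0 0]mxE cxD.
have ME (B : 'M[R]_1) : map_mx (real_complex R) B 0 0 = cx (B 0 0) by rewrite mxE.
have ZE (z : R[i]) (B : 'M[R[i]]_1) : (z *: B) 0 0 = z * B 0 0 by rewrite mxE.
have DE (B C : 'M[R[i]]_1) : (B + C) 0 0 = B 0 0 + C 0 0 by rewrite mxE.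
by rewrite !DE !ZE !ME; ring.
Qed.

Lemma cqf_real (n : nat) (A : 'M[R]_n) (u : 'rV[R]_n) :
  cqf A (map_mx cx u) = cx ((u *m A *m u^T) 0 0).
Proof.
have -> : map_mx cx u = map_mx cx u + (0 : R[i]) *: map_mx cx u.
  by rewrite scale0r addr0.
by rewrite cqf_line expr0n !mulr0 !addr0.
Qed.

Lemma cqf_mulmx (m n : nat) (Q : 'M[R]_m) (T : 'M[R]_(n, m)) (v : 'rV[R[i]]_n) :
  cqf Q (v *m map_mx cx T) = cqf (T *m Q *m T^T) v.
Proof.
rewrite /cqf (map_mxM (real_complex R)) (map_mxM (real_complex R)) trmx_mul.
by rewrite !mulmxA -!map_trmx.
Qed.

Lemma cqfZ (n : nat) (a : R) (A : 'M[R]_n) v : cqf (a *: A) v = cx a * cqf A v.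
Proof.
by rewrite /cqf (map_mxZ (real_complex R)) -scalemxAr -scalemxAl mxE.
Qed.

Lemma quad_delta (n : nat) (A : 'M[R]_n) (i j : 'I_n) :
  ((delta_mx 0 i : 'rV[R]_n) *m A *m (delta_mx 0 j : 'rV[R]_n)^T) 0 0 = A i j.
Proof. by rewrite trmx_delta -rowE -colE mxE mxE. Qed.

Lemma polarization_eq (n : nat) (A B : 'M[R]_n) :
  (forall u : 'rV[R]_n, (u *m A *m u^T) 0 0 = (u *m B *m u^T) 0 0) ->
  A + A^T = B + B^T.
Proof.
move=> h; apply/matrixP => i j.
have := h (delta_mx 0 i + delta_mx 0 j : 'rV[R]_n).
rewrite linearD /= !mulmxDl !mulmxDr.
have e (M : 'M[R]_n) k l : ((delta_mx 0 k : 'rV[R]_n) *m M *m (delta_mx 0 l :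
  'rV[R]_n)^T) 0 0 = M k l
  by exact: quad_delta.
have DE (M N : 'M[R]_1) : (M + N) 0 0 = M 0 0 + N 0 0 by rewrite mxE.
rewrite !DE !e; have := h (delta_mx 0 i); have := h (delta_mx 0 j).
rewrite !e => -> ->; rewrite -!addrA => /addrI; rewrite !addrA => /addIr; rewrite !mxE.
by [].
Qed.

(* Restricted to a complex line u + t w with w nonisotropic, both forms are
   genuine quadratic polynomials in t, hence proportional to each other as
   soon as they have the same roots. *)
Lemma proportional_of_same_null_cone (n : nat) (A B : 'M[R]_n) :
  A^T = A -> A != 0 -> (forall v, cqf A v = 0 <-> cqf B v = 0) ->
  exists c : R, A = c *: (B + B^T).
Proof.
move=> sA A0 h.
have [w wA] : exists w : 'rV[R]_n, (w *m A *m w^T) 0 0 != 0.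
  apply: contrapT => /forallNP hn; case/eqP: A0.
  have : A + A^T = 0 + 0^T.
    apply: polarization_eq => u; rewrite mulmx0 mul0mx [RHS]mxE.
    by apply/eqP/negPn/negP; apply: hn.
  rewrite sA trmx0 addr0 -mulr2n => /eqP; rewrite -scaler_nat scaler_eq0 pnatr_eq0 /=.
  by move/eqP.
have cx0 (x : R) : (cx x == 0) = (x == 0) by apply/eqP/eqP => [[]|->].
have wB : (w *m B *m w^T) 0 0 != 0.
  apply: contra wA => /eqP wB; rewrite -cx0 -cqf_real; apply/eqP/h.
  by rewrite cqf_real wB.
(* The ratio of the values at w serves for all u: it is the ratio of leading coefficients on every
   line u + t w. *)
have key (u : 'rV[R]_n) : (u *m A *m u^T) 0 0 =
    (u *m ((w *m A *m w^T) 0 0 / (w *m B *m w^T) 0 0 *: B) *m u^T) 0 0.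
  rewrite -scalemxAr -scalemxAl [RHS]mxE mulrAC; apply: (canRL (mulfK wB)).
  have := @proportional_of_same_zeros (cx ((w *m A *m w^T) 0 0)) (cx ((u *m A *m w^T
    + w *m A *m u^T) 0 0))
    (cx ((u *m A *m u^T) 0 0)) (cx ((w *m B *m w^T) 0 0)) (cx ((u *m B *m w^T + w *m
      B *m u^T) 0 0))
    (cx ((u *m B *m u^T) 0 0)).
  rewrite !cx0 => /(_ wA wB) pr.
  have : (cx ((w *m B *m w^T) 0 0)) * (cx ((u *m A *m u^T) 0 0)) =
     cx ((w *m A *m w^T) 0 0) * (cx ((u *m B *m u^T) 0 0)).
    by apply: pr => t; rewrite -!cqf_line.
  rewrite -!(rmorphM (real_complex R)) => -[]; by rewrite mulrC.
have := polarization_eq key; rewrite sA linearZ /= -scalerDr.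
set k := _ / _ => e; exists (2^-1 * k).
by rewrite -scalerA -e -mulr2n -[A *+ 2]scaler_nat scalerA mulVf ?scale1r // pnatr_eq0.
Qed.

End QuadraticForms.

(** * Cones over a quadric in a hyperplane, null lines and linearizability *)

Section Cones.
Variables (R : realType) (n : nat).
Implicit Types (L : 'rV[R]_(n + 1)) (Q : 'M[R]_(n + 1)) (p : 'rV[R]_n)
  (U : set 'rV[R]_n) (F : 'rV[R]_n -> 'M[R]_n).

(* The matrix of v |-> L(P) V - L(V) P for P = (p, 1) and V = (v, 0), the
   intersection point of the line through P and V with the hyperplane L. *)
Definition hyperplane_proj L p : 'M[R]_(n, n + 1) :=
  (row_mx p 1 *m L^T) 0 0 *: row_mx 1%:M 0 - (lsubmx L)^T *m row_mx p 1.

Definition null_cones_over_quadric U F : Prop :=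
  exists L Q, L != 0 /\ forall p, U p ->
    (row_mx p 1 *m L^T) 0 0 != 0 /\
    exists mu, F p = mu *: (hyperplane_proj L p *m Q *m (hyperplane_proj L p)^T).

Lemma line_meets_quadricE L Q p v :
  line_meets_quadric L Q p v <->
  cqf (hyperplane_proj L p *m Q *m (hyperplane_proj L p)^T) v = 0.
Proof.
rewrite -cqf_mulmx /line_meets_quadric /=.
suff -> : v *m map_mx cx (hyperplane_proj L p) =
  (hpt p *m (map_mx cx L)^T) 0 0 *: hdir v - (hdir v *m (map_mx cx L)^T) 0 0 *: hpt p
    by [].
rewrite /hyperplane_proj (map_mxB (real_complex R)) (map_mxZ (real_complex R)).
rewrite (map_mxM (real_complex R)) mulmxBr -scalemxAr; congr (_ - _).
  rewrite map_row_mx (map_mx1 (real_complex R)) (map_mx0 (real_complex R)).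
  rewrite mul_mx_row mulmx1 mulmx0; congr (_ *: _).
  rewrite /hpt map_trmx -(map_mxM (real_complex R)) [RHS]mxE //.
rewrite mulmxA -mul_scalar_mx; congr (_ *m _).
rewrite [LHS]mx11_scalar; congr (_ %:M).
by rewrite /hdir -[L in RHS]hsubmxK map_row_mx tr_row_mx mul_row_col mul0mx addr0
  map_trmx.
Qed.

(** Proportional forms have the same zeros; the converse is [proportional_of_same_null_cone], whose
    symmetrized right-hand side makes [Q + Q^T] the witness. *)
Lemma null_complex_through_quadricP U F : (0 < n)%N ->
  (forall p, U p -> (F p)^T = F p /\ \det (F p) != 0) ->
  null_cones_over_quadric U F <-> null_complex_through_quadric U F.
Proof.
move=> n_gt0 hF.
have F_neq0 p : U p -> F p != 0.
  move=> /hF[_]; apply: contraNneq => ->.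
  by rewrite -(ltn_predK n_gt0) det0.
split=> -[L [Q [L0 h]]].
  exists L, Q; split=> // p Up; have [l0 [mu eF]] := h p Up; split=> // v.
  have mu0 : mu != 0.
    by apply: contraNneq (F_neq0 p Up) => mu0; rewrite eF mu0 scale0r.
  rewrite line_meets_quadricE /null_dir eF cqfZ; split=> [/eqP|->]; last by rewrite
    mulr0.
  rewrite mulf_eq0 => /orP[|/eqP//]; rewrite eqE /= => /andP[].
  by rewrite (negPf mu0).
exists L, (Q + Q^T); split=> // p Up; have [l0 hv] := h p Up; split=> //.
have [|c ->] := @proportional_of_same_null_cone R n (F p)
    (hyperplane_proj L p *m Q *m (hyperplane_proj L p)^T) (proj1 (hF p Up)) (F_neq0 p
      Up).
  by move=> v; rewrite -line_meets_quadricE; apply: hv.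
exists c; congr (_ *: _).
by rewrite mulmxDr mulmxDl !trmx_mul trmxK mulmxA.
Qed.

(* The hyperplane L is spanned by the rows of [C, -b]. *)
Lemma hyperplane_projE (C : 'M[R]_n) (b : 'cV[R]_n) L p :
  row_mx C (- b) *m L^T = 0 ->
  (C + b *m p) *m hyperplane_proj L p = (row_mx p 1 *m L^T) 0 0 *: row_mx C (- b).
Proof.
rewrite -{1}[L]hsubmxK tr_row_mx mul_row_col mulNmx => /eqP; rewrite subr_eq0 => /eqP e.
rewrite /hyperplane_proj mulmxBr -scalemxAr mulmxA (mulmxDl _ _ (lsubmx L)^T) e
  -(mulmxA b p) -mulmxDr.
have -> : (rsubmx L)^T + p *m (lsubmx L)^T = row_mx p 1 *m L^T.
  by rewrite -[in RHS](hsubmxK L) tr_row_mx mul_row_col mul1mx addrC.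
rewrite [row_mx p 1 *m L^T in X in _ - X]mx11_scalar mul_mx_scalar -scalemxAl -scalerBr.
congr (_ *: _).
rewrite mul_mx_row mulmx1 mulmx0 mul_mx_row mulmx1 opp_row_mx add_row_mx sub0r.
by rewrite addrK.
Qed.

(** A basis of the orthogonal complement of x is completed by x itself, independent of it because
    x^T x is a nonzero sum of squares. Rescaling the last row fixes the determinant and keeps the
    first n rows. *)
Lemma exists_unimodular_annihilator (x : 'cV[R]_(n + 1)) : x != 0 ->
  exists M : 'M[R]_(n + 1), \det M = 1 /\ usubmx M *m x = 0.
Proof.
move=> x0.
have [E [fE Ex]] : exists E : 'M[R]_(n, n + 1), row_free E /\ E *m x = 0.
  have rk : \rank (kermx x) = n.
    have rx : \rank x = 1%N.
      apply/eqP; rewrite eqn_leq rank_leq_col lt0n.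
      by rewrite mxrank_eq0.
    by rewrite mxrank_ker rx addnK.
  have : exists E : 'M[R]_(\rank (kermx x), n + 1), row_free E /\ E *m x = 0.
    exists (row_base (kermx x)); split; first exact: row_base_free.
    by apply/sub_kermxP; rewrite eq_row_base.
  by rewrite rk.
have xx : (x^T *m x) 0 0 != 0.
  rewrite mxE psumr_eq0 => [|i _]; last by rewrite mxE -expr2 sqr_ge0.
  apply: contra x0 => /allP h; apply/eqP/matrixP => i j; rewrite ord1 mxE.
  by have := h i (mem_index_enum _); rewrite /= mxE mulf_eq0 orbb => /eqP.
pose M := col_mx E x^T.
have d0 : \det M != 0.
  apply/det0P => -[w w0 wM].
  move: w0 wM; rewrite -[w]hsubmxK mul_row_col; set w1 := lsubmx w; set s := rsubmx w.
  move=> w0 wM; have := wM; move=> /(congr1 (mulmx^~ x)); rewrite mulmxDl -mulmxA Ex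
    mulmx0 add0r mul0mx.
  rewrite [s]mx11_scalar mul_scalar_mx -scalemxAl => /matrixP/(_ 0 0).
  rewrite [LHS]mxE [RHS]mxE => /eqP; rewrite mulf_eq0 (negPf xx) orbF => /eqP s0.
  move: wM; rewrite [s]mx11_scalar s0 raddf0 mul0mx addr0 => /eqP.
  rewrite mulmx_free_eq0 // => /eqP w10; case/eqP: w0.
  by rewrite w10 [s]mx11_scalar s0 raddf0 row_mx0.
exists (block_mx 1%:M 0 0 (\det M)^-1%:M *m M); split.
  by rewrite det_mulmx det_lblock det1 mul1r det_scalar expr1 mulVf.
by rewrite mul_block_col col_mxKu mul1mx mul0mx addr0 Ex.
Qed.

Lemma linearizable_coneP U F : (0 < n)%N ->
  (forall p, U p -> (F p)^T = F p /\ \det (F p) != 0) ->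
  linearizable U F <-> null_cones_over_quadric U F.
Proof.
move=> n_gt0 hF; split.
  move=> [M [dM [A h]]].
  have uM : M \in unitmx by rewrite unitmxE dM unitr1.
  pose N := invmx M; pose C := ulsubmx M; pose b := ursubmx M.
  have eMN : row_mx C b *m row_mx (lsubmx N) (rsubmx N) = row_mx 1%:M 0.
    have : M *m N = 1%:M by rewrite mulmxV.
    rewrite -{1}[M]vsubmxK mul_col_mx (scalar_mx_block n 1) => /eq_col_mx[].
    by rewrite hsubmxK -[usubmx M]hsubmxK.
  move: eMN; rewrite mul_mx_row => /eq_row_mx[e1 e2].
  (* By M N = 1, the last column of N is annihilated by [C, b] and its first n columns are a right
     inverse of [C, b]. Negating the last row of N turns b into -b. *)
  pose L : 'rV[R]_(n + 1) := (col_mx (usubmx (rsubmx N)) (- dsubmx (rsubmx N)))^T.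
  pose Ep := col_mx (usubmx (lsubmx N)) (- dsubmx (lsubmx N)).
  have EL : row_mx C (- b) *m L^T = 0.
    by rewrite trmxK mul_row_col mulmxN mulNmx opprK -mul_row_col vsubmxK.
  have EEp : row_mx C (- b) *m Ep = 1%:M.
    by rewrite mul_row_col mulmxN mulNmx opprK -mul_row_col vsubmxK.
  have L0 : L != 0.
    apply/eqP => L0; have : rsubmx N = 0.
      have : col_mx (usubmx (rsubmx N)) (- dsubmx (rsubmx N)) = 0.
        by apply: trmx_inj; rewrite trmx0.
      rewrite -[0]vsubmxK => /eq_col_mx[u1 /(congr1 -%R) u2].
      rewrite -[rsubmx N]vsubmxK u1; rewrite opprK in u2; rewrite u2.
      by rewrite !linear0 ?oppr0 col_mx0.
    move=> rN; have : M *m N = 1%:M by rewrite mulmxV.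
    rewrite -[N]hsubmxK rN mul_mx_row mulmx0 => /matrixP/(_ (rshift n ord0) (rshift n
      ord0)).
    by rewrite row_mxEr !mxE eqxx => /esym/eqP; rewrite oner_eq0.
  (* Since Ep is a right inverse of [C, -b], this form restricts to A on the rows of [C, -b]. *)
  exists L, (Ep *m A *m Ep^T); split=> // p Up.
  have [d0 [lam e]] := h p Up.
  rewrite -/C -/b in d0 e.
  have uC : C + b *m p \in unitmx by rewrite unitmxE unitfE.
  have eT := @hyperplane_projE C b L p EL.
  (* If L vanished at (p, 1), the invertible C + b p would kill [hyperplane_proj L p], so that this
     matrix, and with it both blocks of L, would be zero. *)
  have l0 : (row_mx p 1 *m L^T) 0 0 != 0.
    apply/eqP => l0; move: eT; rewrite l0 scale0r => /(congr1 (mulmx (invmx (C + b *m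
      p)))).
    rewrite mulKmx // mulmx0 /hyperplane_proj l0 scale0r sub0r => /eqP; rewrite
      oppr_eq0.
    rewrite mul_mx_row mulmx1 => /eqP; rewrite -[0]hsubmxK => /eq_row_mx[_ a0].
    have {}a0 : lsubmx L = 0 by apply: trmx_inj; rewrite a0 !linear0.
    have r0 : rsubmx L = 0.
      move: l0; rewrite -[L in L^T]hsubmxK a0 tr_row_mx mul_row_col trmx0 mulmx0
        add0r mul1mx mxE.
      by move=> r0; rewrite [rsubmx L]mx11_scalar r0 raddf0.
    by case/eqP: L0; rewrite -[L]hsubmxK a0 r0 row_mx0.
  split=> //; set l := (_ *m L^T) 0 0 in l0 eT.
  (* Congruence by C + b p turns F into lam / det times A, and the cone form into l^2 times A. *)
  exists (lam / (l ^+ 2 * \det (C + b *m p))).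
  set T := hyperplane_proj L p in eT *.
  have eA : (C + b *m p) *m (T *m (Ep *m A *m Ep^T) *m T^T) *m (C + b *m p)^T = l ^+
    2 *: A.
    rewrite !mulmxA eT -!mulmxA -trmx_mul eT !mulmxA linearZ /= -scalemxAr
      -!scalemxAl scalerA -expr2.
    by rewrite EEp mul1mx -mulmxA -trmx_mul EEp trmx1 mulmx1.
  have inj (X Y : 'M[R]_n) : (C + b *m p) *m X *m (C + b *m p)^T = (C + b *m p) *m Y
    *m (C + b *m p)^T -> X = Y.
    move=> /(congr1 (mulmx^~ (invmx (C + b *m p)^T))); rewrite !mulmxK ?unitmx_tr //.
    by move=> /(congr1 (mulmx (invmx (C + b *m p)))); rewrite !mulKmx.
  apply: inj; rewrite -scalemxAr -scalemxAl eA scalerA.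
  apply: (scalerI d0); rewrite e scalerA; congr (_ *: _).
  by field; rewrite d0 l0.
move=> [L [Q [L0 h]]].
(* The first n rows of M must annihilate L with its last entry negated, so that [C, -b] annihilates
   L. *)
have [M [dM eM]] : exists M : 'M[R]_(n + 1), \det M = 1 /\
    usubmx M *m col_mx (lsubmx L)^T (- (rsubmx L)^T) = 0.
  apply: exists_unimodular_annihilator; apply/eqP => e0; case/eqP: L0.
  move: e0; rewrite -[0]vsubmxK => /eq_col_mx[u1 /(congr1 -%R)]; rewrite opprK => u2.
  by apply: trmx_inj; rewrite -[L]hsubmxK tr_row_mx u1 u2 !linear0 ?oppr0 col_mx0.
exists M; split=> //.
pose C := ulsubmx M; pose b := ursubmx M.
have EL : row_mx C (- b) *m L^T = 0.
  rewrite -[L]hsubmxK tr_row_mx mul_row_col mulNmx -mulmxN -mul_row_col.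
  by rewrite -eM -[usubmx M]hsubmxK.
exists (row_mx C (- b) *m Q *m (row_mx C (- b))^T) => p Up; rewrite -/C -/b /=.
have [l0 [mu eF]] := h p Up.
have eT := @hyperplane_projE C b L p EL.
set l := (_ *m L^T) 0 0 in l0 eT.
split; last first.
  exists (\det (C + b *m p) * mu * l ^+ 2).
  rewrite eF -scalemxAr -scalemxAl scalerA -[in RHS]scalerA; congr (_ *: _).
  rewrite !mulmxA eT -!mulmxA -trmx_mul eT !mulmxA linearZ /= -scalemxAr -!scalemxAl.
  by rewrite scalerA -expr2.
(* As L(P) is nonzero, a left kernel vector w of C + b p kills [C, -b], hence [C, b], so (w, 0) is
   in the left kernel of M. *)
apply/det0P => -[w w0 wC].
have wE : w *m row_mx C (- b) = 0.
  have := congr1 (mulmx w) eT; rewrite mulmxA wC mul0mx -scalemxAr => /esym/eqP.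
  by rewrite scaler_eq0 (negPf l0) => /eqP.
have wM : w *m row_mx C b = 0.
  move: wE; rewrite !mul_mx_row mulmxN -[0]hsubmxK => /eq_row_mx[-> /(congr1 -%R)].
  by rewrite opprK => ->; rewrite !linear0 ?oppr0 row_mx0.
have : row_mx w 0 *m M = 0.
  by rewrite -[M]vsubmxK mul_row_col mul0mx addr0 -[usubmx M]hsubmxK.
move/(congr1 (mulmx^~ (invmx M))); rewrite mulmxK ?unitmxE ?dM ?unitr1 // mul0mx.
by rewrite -[in RHS](row_mx0 R 1 n 1) => /eq_row_mx[w00 _]; rewrite w00 eqxx in w0.
Qed.

End Cones.

(** * The Hessian of a quadratic polynomial divided by a linear one *)

Section Hessian.
Variables (R : realType) (n : nat).

(** The difference quotient is exactly b + h c. *)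
Lemma is_derive_quadratic (f : 'rV[R]_n -> R) (p v : 'rV[R]_n) (b c : R) :
  (forall h, f (h *: v + p) = f p + h * b + h ^+ 2 * c) -> is_derive p v f b.
Proof.
move=> hf.
have cv : h^-1 *: ((f \o shift p) (h *: v) - f p) @[h --> (0 : R)^'] --> b.
  have e : \forall h \near (0 : R)^', b + h * c = h^-1 *: ((f \o shift p) (h *: v) -
    f p).
    near=> h; have h0 : h != 0 by near: h; exact: nbhs_dnbhs_neq.
    by rewrite /= hf /GRing.scale /=; field.
  apply: cvg_trans; first exact: near_eq_cvg e.
  have : b + h * c @[h --> (0 : R)] --> b + 0 * c.
    by apply: cvgD; [exact: cvg_cst | apply: cvgM; [exact: cvg_id|exact: cvg_cst]].
  by rewrite mul0r addr0; apply: cvg_trans; apply: cvg_app; exact: nbhs_dnbhs.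
apply: DeriveDef; first by apply/cvg_ex; exists b.
exact: cvg_lim cv.
Unshelve. all: by end_near. Qed.

(** Inhomogeneous polynomials are encoded as forms at (p, 1); moving p by h v then adds h (v, 0) to
    the homogeneous vector. *)
Definition hquad (Q : 'M[R]_(n + 1)) (p : 'rV[R]_n) : R :=
  (row_mx p 1 *m Q *m (row_mx p 1)^T) 0 0.
Definition hlin (L : 'rV[R]_(n + 1)) (p : 'rV[R]_n) : R := (row_mx p 1 *m L^T) 0 0.

Local Notation dirv v := (row_mx v (0 : 'M[R]_1)).

Lemma row_mx_shift (h : R) (v p : 'rV[R]_n) :
  row_mx (h *: v + p) 1 = row_mx p 1 + h *: dirv v :> 'rV[R]_(n + 1).
Proof. by rewrite scale_row_mx add_row_mx scaler0 addr0 addrC. Qed.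

Lemma mulmx_entryD m (A B : 'M[R]_m) i j : (A + B) i j = A i j + B i j.
Proof. by rewrite mxE. Qed.

Lemma is_derive_hquad Q p v : is_derive p v (hquad Q)
  ((row_mx p 1 *m (Q + Q^T) *m (dirv v)^T) 0 0).
Proof.
have -> : (row_mx p 1 *m (Q + Q^T) *m (dirv v)^T) 0 0 =
    (row_mx p 1 *m Q *m (dirv v)^T + dirv v *m Q *m (row_mx p 1)^T) 0 0.
  rewrite mulmxDr mulmxDl !mulmx_entryD; congr (_ + _).
  have -> : row_mx p 1 *m Q^T *m (dirv v)^T = (dirv v *m Q *m (row_mx p 1)^T)^T.
    by rewrite !trmx_mul trmxK mulmxA.
  by rewrite mxE.
apply: (@is_derive_quadratic _ p v _ ((dirv v *m Q *m (dirv v)^T) 0 0)) => h.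
rewrite /hquad row_mx_shift linearD /= linearZ /= !mulmxDl !mulmxDr.
rewrite -?scalemxAl -?scalemxAr -?scalemxAl ?scalerA !mulmx_entryD.
have ZE (z : R) (B : 'M[R]_1) : (z *: B) 0 0 = z * B 0 0 by rewrite mxE.
by rewrite !ZE; ring.
Qed.

Lemma is_derive_hform (w : 'cV[R]_(n + 1)) p v :
  is_derive p v (fun q => (row_mx q 1 *m w) 0 0) ((dirv v *m w) 0 0).
Proof.
apply: (@is_derive_quadratic _ p v _ 0) => h.
by rewrite row_mx_shift mulmxDl -scalemxAl mxE [X in _ + X]mxE mulr0 addr0.
Qed.

Lemma is_derive_inv_hlin L p v : hlin L p != 0 ->
  is_derive p v (fun q => (hlin L q)^-1)
    (- (dirv v *m L^T) 0 0 * (hlin L p)^-1 ^+ 2).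
Proof.
move=> l0; have dl : is_derive p v (hlin L) ((dirv v *m L^T) 0 0) := is_derive_hform
  L^T p v.
apply: DeriveDef; first by apply: derivableV => //; exact: ex_derive.
by rewrite deriveV // derive_val /GRing.scale /= exprVn mulrC mulrN mulNr.
Qed.

(** The derivative of the numerator is bracketed as [row_mx p 1] times a fixed column, ready for a
    second differentiation by [is_derive_hform]. *)
Lemma derive_quotient Q L p v : hlin L p != 0 ->
  is_derive p v (fun q => hquad Q q / hlin L q)
  ((row_mx p 1 *m ((Q + Q^T) *m (dirv v)^T)) 0 0 / hlin L p
     - hquad Q p * ((dirv v *m L^T) 0 0 * (hlin L p)^-1 ^+ 2)).
Proof.
move=> l0; have dh := is_derive_inv_hlin v l0; have df := is_derive_hquad Q p v.
have H : is_derive p v (fun q => hquad Q q / hlin L q) _ := is_deriveM df dh.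
apply: (is_derive_eq H).
by rewrite /GRing.scale /= mulmxA; ring.
Qed.

Lemma mul_hyperplane_proj L p v : v *m hyperplane_proj L p =
  hlin L p *: dirv v - (dirv v *m L^T) 0 0 *: row_mx p 1.
Proof.
rewrite /hyperplane_proj mulmxBr -scalemxAr mul_mx_row mulmx1 mulmx0; congr (_ - _).
rewrite mulmxA -mul_scalar_mx; congr (_ *m _); rewrite -mx11_scalar.
by rewrite -[L in RHS]hsubmxK tr_row_mx mul_row_col mul0mx addr0.
Qed.

Lemma form_sub_scale m (S : 'M[R]_m) (x y z : 'rV[R]_m) (a b c : R) :
  ((a *: x - b *: z) *m S *m (a *: y - c *: z)^T) 0 0 =
  a ^+ 2 * (x *m S *m y^T) 0 0 - a * c * (x *m S *m z^T) 0 0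
   - b * a * (z *m S *m y^T) 0 0 + b * c * (z *m S *m z^T) 0 0.
Proof.
have -> : (a *: y - c *: z)^T = a *: y^T - c *: z^T by rewrite linearB /= !linearZ.
rewrite !mulmxBl !mulmxBr -?scalemxAl -?scalemxAr -?scalemxAl.
have ZE (t : R) (B : 'M[R]_1) : (t *: B) 0 0 = t * B 0 0 by rewrite mxE.
have BE (B C : 'M[R]_1) : (B - C) 0 0 = B 0 0 - C 0 0 by rewrite !mxE.
by rewrite !(BE, ZE); ring.
Qed.

Lemma symmetric_form_comm m (S : 'M[R]_m) (x y : 'rV[R]_m) : S^T = S ->
  (x *m S *m y^T) 0 0 = (y *m S *m x^T) 0 0.
Proof.
move=> sS; have -> : x *m S *m y^T = (y *m S *m x^T)^T.
  by rewrite !trmx_mul trmxK sS mulmxA.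
by rewrite mxE.
Qed.

(** With S = Q + Q^T, the quotient rule applied twice and multiplied by L(P)^3 gives L(P)^2 S(V, W)
    - L(P) L(W) S(V, P) - L(P) L(V) S(P, W) + L(V) L(W) S(P, P), that is, S at the pair L(P) V -
    L(V) P, L(P) W - L(W) P. *)
Lemma hessian_quotient Q L p : (\near p, hlin L p != 0) ->
  hessian (fun q => hquad Q q / hlin L q) p =
  (hlin L p)^-1 ^+ 3 *:
    (hyperplane_proj L p *m (Q + Q^T) *m (hyperplane_proj L p)^T).
Proof.
move=> lnear; have l0 : hlin L p != 0 by exact: nbhs_singleton lnear.
apply/matrixP => i j; rewrite mxE.
set v : 'rV[R]_n := delta_mx 0 i; set w : 'rV[R]_n := delta_mx 0 j.
(* G is the first derivative along v, built from functions with known derivatives; the agreement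
   holds where L is nonzero, hence near p. *)
pose G := (fun q => (row_mx q 1 *m ((Q + Q^T) *m (dirv v)^T)) 0 0)
   * (fun q => (hlin L q)^-1)
   - (hquad Q * (((dirv v *m L^T) 0 0) *: ((fun q => (hlin L q)^-1) * (fun q => (hlin
     L q)^-1)))).
have -> : 'D_w (fun q => 'D_v (fun q0 => hquad Q q0 / hlin L q0) q) p = 'D_w G p.
  apply: near_eq_derive; near=> q.
  have lq : hlin L q != 0 by near: q.
  have := derive_quotient Q v lq => /@derive_val ->.
  by rewrite /G /= /GRing.scale /= expr2.
have dh := is_derive_inv_hlin w l0.
have d1 := is_derive_hform ((Q + Q^T) *m (dirv v)^T) p w.
have df := is_derive_hquad Q p w.
have dG : is_derive p w G _ :=
  is_deriveB (is_deriveM d1 dh) (is_deriveM df (is_deriveZ ((dirv v *m L^T) 0 0)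
    (is_deriveM dh dh))).
rewrite (@derive_val _ _ _ _ _ _ _ dG) /GRing.scale /=.
have sS : (Q + Q^T)^T = Q + Q^T by rewrite linearD /= trmxK addrC.
have hS : (row_mx p 1 *m (Q + Q^T) *m (row_mx p 1)^T) 0 0 = 2 * hquad Q p.
  rewrite mulmxDr mulmxDl mulmx_entryD -/(hquad Q p).
  have -> : row_mx p 1 *m Q^T *m (row_mx p 1)^T = (row_mx p 1 *m Q *m (row_mx p 1)^T)^T.
    by rewrite !trmx_mul trmxK mulmxA.
  by rewrite [_^T _ _]mxE -/(hquad Q p); ring.
rewrite [RHS]mxE -[X in _ = _ * X]quad_delta -/v -/w.
have -> : v *m (hyperplane_proj L p *m (Q + Q^T) *m (hyperplane_proj L p)^T) *m w^T =
    (v *m hyperplane_proj L p) *m (Q + Q^T) *m (w *m hyperplane_proj L p)^T.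
  by rewrite trmx_mul !mulmxA.
move: sS hS; rewrite !mul_hyperplane_proj !mulmxA; set S := Q + Q^T => sS hS.
set V := row_mx v 0; set W := row_mx w 0; set P := row_mx p 1; set h := hlin L p.
rewrite form_sub_scale (symmetric_form_comm V P sS) (symmetric_form_comm W V sS).
rewrite hS mulrfctE /GRing.scale /= -!/(hlin L p) -/h.
by field.
Unshelve. all: by end_near.
Qed.

Lemma hlinE L p : hlin L p = lin_poly (lsubmx L) (rsubmx L 0 0) p.
Proof.
rewrite /hlin -{1}[L]hsubmxK tr_row_mx mul_row_col mul1mx mulmx_entryD [X in _ + X]mxE.
by congr (_ + _); rewrite -[p in LHS]trmxK -trmx_mul [LHS]mxE.
Qed.

Lemma hquadE Q p : hquad Q p =
  quad_poly (ulsubmx Q) ((ursubmx Q)^T + dlsubmx Q) (drsubmx Q 0 0) p.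
Proof.
rewrite /hquad /quad_poly -{1}[Q]submxK mul_row_block tr_row_mx mul_row_col trmx1
  mulmx1 !mul1mx.
rewrite !mulmxDl !mulmx_entryD -!addrA; congr (_ + _).
have -> : (p *m ursubmx Q) 0 0 = ((ursubmx Q)^T *m p^T) 0 0.
  by rewrite -trmx_mul [RHS]mxE.
by rewrite addrCA.
Qed.

Lemma lagrangian_coneP (U : set 'rV[R]_n) (F : 'rV[R]_n -> 'M[R]_n) : (0 < n)%N ->
  open U ->
  (forall p, U p -> (F p)^T = F p /\ \det (F p) != 0) ->
  lagrangian_QL U F <-> null_cones_over_quadric U F.
Proof.
move=> n_gt0 oU hF; split.
  move=> [A [B [a [c0 [a0 [hl hH]]]]]].
  pose L : 'rV[R]_(n + 1) := row_mx a a0%:M.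
  pose Q : 'M[R]_(n + 1) := block_mx A 0 B c0%:M.
  have lE q : lin_poly a a0 q = hlin L q.
    by rewrite hlinE row_mxKl row_mxKr mxE eqxx.
  have qE q : quad_poly A B c0 q = hquad Q q.
    by rewrite hquadE block_mxKul block_mxKur block_mxKdl block_mxKdr trmx0 add0r mxE
      eqxx.
  (* That L is nonzero is read off at a point of U; for empty U any nonzero covector is taken. *)
  have [U0|/set0P[p0 Up0]] := eqVneq U set0.
    exists (const_mx 1), 0; split; last by move=> p; rewrite U0.
    by apply/eqP => /matrixP/(_ 0 (rshift n 0)); rewrite !mxE => /eqP; rewrite oner_eq0.
  exists L, (Q + Q^T); split.
    apply/eqP => L0; have := hl p0 Up0.
    by rewrite lE L0 /hlin trmx0 mulmx0 mxE eqxx.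
  move=> p Up; split; first by have := hl p Up; rewrite lE.
  have [lam ->] := hH p Up.
  have -> : (fun q => quad_poly A B c0 q / lin_poly a a0 q) = (fun q => hquad Q q /
    hlin L q).
    by apply/funext => q; rewrite lE qE.
  rewrite hessian_quotient; first by eexists; rewrite scalerA.
  by near=> q; rewrite -lE; apply: hl; near: q; exact: open_nbhs_nbhs.
move=> [L [Q [L0 h]]].
exists (ulsubmx Q), ((ursubmx Q)^T + dlsubmx Q), (lsubmx L), (drsubmx Q 0 0), (rsubmx
  L 0 0).
split=> [p Up|p Up]; first by rewrite -hlinE; exact: (h p Up).1.
have -> : (fun q => quad_poly (ulsubmx Q) ((ursubmx Q)^T + dlsubmx Q) (drsubmx Q 0 0)
  q /
    lin_poly (lsubmx L) (rsubmx L 0 0) q) = (fun q => hquad Q q / hlin L q).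
  by apply/funext => q; rewrite -hlinE -hquadE.
rewrite hessian_quotient; last first.
  by near=> q; apply: (h q _).1; near: q; exact: open_nbhs_nbhs.
have [l0 [mu eF]] := h p Up; rewrite -/(hlin L p) in l0.
(* The cube cancels the factor in [hessian_quotient], and the half offsets the passage from Q to Q +
   Q^T. *)
exists (2^-1 * mu * hlin L p ^+ 3); rewrite scalerA.
have -> : 2^-1 * mu * hlin L p ^+ 3 * (hlin L p)^-1 ^+ 3 = 2^-1 * mu by field.
have [sF _] := hF p Up.
have e : F p + (F p)^T = mu *: (hyperplane_proj L p *m (Q + Q^T) *m (hyperplane_proj
  L p)^T).
  rewrite eF linearZ /= -scalerDr; congr (_ *: _).
  by rewrite mulmxDr mulmxDl !trmx_mul trmxK mulmxA.
by rewrite -scalerA -e sF -[F p + F p]mulr2n -[F p *+ 2]scaler_nat scalerA mulVf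
  ?scale1r // pnatr_eq0.
Unshelve. all: by end_near. Qed.

End Hessian.

(** * Plücker coordinates, contraction with a covector and the Klein form *)

Section Plucker.
Variable R : realType.
Implicit Types (L X Y : 'rV[R]_4) (p : 'rV[R]_3).

Lemma pl_iE (k : 'I_6) : pl_i k = nth 0%N [:: 0; 0; 0; 1; 1; 2]%N k :> nat.
Proof. by rewrite /pl_i inordK //; case: k => [[|[|[|[|[|[|]]]]]]]. Qed.

Lemma pl_jE (k : 'I_6) : pl_j k = nth 0%N [:: 1; 2; 3; 2; 3; 3]%N k :> nat.
Proof. by rewrite /pl_j inordK //; case: k => [[|[|[|[|[|[|]]]]]]]. Qed.

Lemma sum_ord4 (V : nmodType) (f : 'I_4 -> V) :
  \sum_i f i = f (inord 0) + f (inord 1) + f (inord 2) + f (inord 3).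
Proof.
rewrite !big_ord_recl big_ord0 addr0 !addrA.
by congr (f _ + f _ + f _ + f _); apply: val_inj; rewrite /= inordK.
Qed.

(** The interior product of bivectors with L: row k is the image of the k-th basis bivector, while
    column l holds the Plücker coordinates of L and the l-th basis covector. *)
Definition contraction_mx L : 'M[R]_(6, 4) :=
  \matrix_(k, l) (L 0 (pl_i k) *+ (l == pl_j k :> nat)
    - L 0 (pl_j k) *+ (l == pl_i k :> nat)).

Lemma plucker_contraction L X Y : plucker X Y *m contraction_mx L =
  (X *m L^T) 0 0 *: Y - (Y *m L^T) 0 0 *: X.
Proof.
apply/rowP => l; rewrite -[l]inord_val !mxE !sum_ord4 !mxE !big_ord_recl !big_ord0 !mxE.
rewrite !pl_iE !pl_jE /pl_i /pl_j !inordK // /=.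
case: l => [[|[|[|[|//]]]] ?] /=; rewrite ?mulr0n ?mulr1n; ring.
Qed.

(** Contracting twice with L gives zero; this bounds the rank of the contraction by 3. *)
Lemma contraction_mx_ker L : contraction_mx L *m L^T = 0.
Proof.
apply/matrixP => k z; rewrite ord1 !mxE !sum_ord4 !mxE !pl_iE !pl_jE /pl_i /pl_j
  !inordK //.
case: k => [[|[|[|[|[|[|//]]]]]] ?] /=; rewrite ?mulr0n ?mulr1n; ring.
Qed.

Lemma klein_tr : klein^T = klein :> 'M[R]_6.
Proof.
apply/matrixP => i j; rewrite !mxE.
by case: i => [[|[|[|[|[|[|//]]]]]] ?]; case: j => [[|[|[|[|[|[|//]]]]]] ?].
Qed.

Lemma mul_klein m (A : 'M[R]_(m, 6)) i j :
  (A *m klein) i j = (-1) ^+ ((j == 1%N :> nat) || (j == 4%N :> nat)) * A i (rev_ord j).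
Proof.
rewrite mxE (bigD1 (rev_ord j)) //= big1 => [|k kj]; last first.
  rewrite mxE; case: eqP => [e|]; last by rewrite mulr0.
  by case/eqP: kj; apply: val_inj => /=; rewrite subSS; apply/eqP; rewrite
    -(eqn_add2r j) e subnK // -ltnS ltn_ord.
rewrite mxE addr0 mulrC; congr (_ * _).
by case: j => [[|[|[|[|[|[|//]]]]]] ?] /=; rewrite ?expr0 ?expr1.
Qed.

Lemma klein_sqr : klein *m klein = 1%:M :> 'M[R]_6.
Proof.
apply/matrixP => i j; rewrite mul_klein !mxE.
case: i => [[|[|[|[|[|[|//]]]]]] ?]; case: j => [[|[|[|[|[|[|//]]]]]] ?] /=;
 rewrite ?expr0 ?expr1 ?mulr0 ?mulr1 ?mulrNN ?mulr1 //.
Qed.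

(** The columns are bivectors with the common factor L, and the wedge of two such bivectors
    vanishes. *)
Lemma contraction_klein L : (contraction_mx L)^T *m klein *m contraction_mx L = 0.
Proof.
apply/matrixP => i j; rewrite [LHS]mxE [RHS]mxE !big_ord_recl big_ord0 !mul_klein.
rewrite ![_^T _ _]mxE !mxE !pl_jE !pl_iE /pl_i /pl_j /=.
case: i => [[|[|[|[|//]]]] ?]; case: j => [[|[|[|[|//]]]] ?] /=;
 rewrite ?expr0 ?expr1 ?mulr0n ?mulr1n; ring.
Qed.

(** Two lines through X meet: X /\ Y /\ X /\ Z = 0. *)
Lemma plucker_klein X Y Z :
  (plucker X Y *m klein *m (plucker X Z)^T) 0 0 = 0.
Proof.
rewrite mxE !big_ord_recl big_ord0 !mul_klein !mxE /pl_i /pl_j /=.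
rewrite ?expr0 ?expr1; ring.
Qed.

End Plucker.

(** * The lines through a point of the affine chart *)

Section LinesThroughPoint.
Variable R : realType.
Implicit Types (L : 'rV[R]_(3 + 1)) (p : 'rV[R]_3).

Local Notation pt p := (row_mx p 1 : 'rV[R]_(3 + 1)).
Local Notation dir v := (row_mx v 0 : 'rV[R]_(3 + 1)).

(* The bivectors P /\ e_i, where P = (p, 1); they span the lines through P. *)
Definition pencil_mx p : 'M[R]_(3, 6) :=
  \matrix_i plucker (pt p) (dir (delta_mx 0 i)).

Lemma plucker_pencil p (v : 'rV[R[i]]_3) :
  plucker (hpt p) (hdir v) = v *m map_mx cx (pencil_mx p).
Proof.
have E (b : 'I_4) : hdir v 0 b =
    \sum_i v 0 i * cx ((dir (delta_mx 0 i)) 0 b).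
  rewrite /hdir mxE; under eq_bigr do rewrite mxE.
  case: (@fintype.split 3 1 b) => j; last by rewrite !mxE big1 // => i _; exact: mulr0.
  rewrite (bigD1 j) //= big1 => [|i ij]; rewrite mxE !eqxx /=.
    by rewrite addr0 mulr1.
  by rewrite eq_sym (negPf ij) mulr0.
apply/rowP => k; rewrite [LHS]mxE [RHS]mxE !E !mulr_sumr -sumrB; apply: eq_bigr => i _.
have hE b : hpt p 0 b = cx (pt p 0 b) by rewrite mxE.
have -> : map_mx cx (pencil_mx p) i k = cx (pt p 0 (pl_i k) * dir (delta_mx 0 i) 0
  (pl_j k)
    - pt p 0 (pl_j k) * dir (delta_mx 0 i) 0 (pl_i k)).
  by rewrite 2!mxE; congr cx; rewrite mxE.
have cxB x y : cx (x - y) = cx x - cx y := rmorphB (real_complex R) x y.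
have cxM x y : cx (x * y) = cx x * cx y := rmorphM (real_complex R) x y.
by rewrite cxB !cxM !hE; ring.
Qed.

(** Contracting P /\ V with L gives L(P) V - L(V) P, so a form on bivectors that factors through the
    contraction yields cones over a quadric in the hyperplane L. *)
Lemma pencil_contraction L p :
  pencil_mx p *m contraction_mx L = hyperplane_proj L p.
Proof.
apply/row_matrixP => i.
by rewrite row_mul rowK plucker_contraction [RHS]rowE mul_hyperplane_proj.
Qed.

Lemma pencil_klein p : pencil_mx p *m klein *m (pencil_mx p)^T = 0.
Proof.
apply/matrixP => i j; rewrite [RHS]mxE -quad_delta.
rewrite -[RHS](plucker_klein (pt p) (dir (delta_mx 0 i)) (dir (delta_mx 0 j))).
have e k : plucker (pt p) (dir (delta_mx 0 k)) = delta_mx 0 k *m pencil_mx p.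
  by rewrite -rowE rowK.
by rewrite !e trmx_mul !mulmxA.
Qed.

(** [col_mx 1%:M (- p)] is the projection from P = (p, 1) onto the directions, so it sends L(P) V -
    L(V) P to L(P) v. *)
Lemma hyperplane_proj_chart L p :
  hyperplane_proj L p *m col_mx 1%:M (- p) = (hlin L p)%:M.
Proof.
rewrite /hyperplane_proj mulmxBl -scalemxAl -mulmxA !mul_row_col mulmx1 mul0mx addr0.
by rewrite mulmx1 mul1mx subrr mulmx0 subr0 scalemx1.
Qed.

Lemma row_mx_inord (v : 'rV[R]_3) (a : 'M[R]_1) (k : nat) : (k < 4)%N ->
  (row_mx v a : 'rV[R]_(3 + 1)) 0 (inord k : 'I_4) = if (k < 3)%N then v 0 (inord k)
    else a 0 0.
Proof.
move=> k4; rewrite mxE; case: splitP => j; rewrite inordK // => ->.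
  by rewrite ltn_ord inord_val.
by rewrite ord1 ltnNge leq_addr.
Qed.

Lemma col_mx_inord (A : 'M[R]_3) (v : 'rV[R]_3) (k : nat) j : (k < 4)%N ->
  (col_mx A v : 'M[R]_(3 + 1, 3)) (inord k : 'I_4) j = if (k < 3)%N then A (inord k)
    j else v 0 j.
Proof.
move=> k4; rewrite mxE; case: splitP => i; rewrite inordK // => ->.
  by rewrite ltn_ord inord_val.
by rewrite ord1 ltnNge leq_addr.
Qed.

Lemma sum_ord3 (V : nmodType) (f : 'I_3 -> V) :
  \sum_i f i = f (inord 0) + f (inord 1) + f (inord 2).
Proof.
rewrite !big_ord_recl big_ord0 addr0 !addrA.
by congr (f _ + f _ + f _); apply: val_inj; rewrite /= inordK.
Qed.

(** T is the cross product by a vector m, so its a-th row is m x e_a up to sign. The line through P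
    in that direction is the meet of two planes through P, given by L = (m, - m p^T) and by column a
    of [col_mx 1%:M (- p)]; [klein] exchanges these two descriptions of a line. *)
Lemma skew_contraction p (T : 'M[R]_3) : T^T = - T -> exists L,
  hlin L p = 0 /\ T *m pencil_mx p *m klein = (contraction_mx L *m col_mx 1%:M (- p))^T.
Proof.
move=> sT.
have sk i j : T i j = - T j i by have := congr1 (fun M : 'M[R]_3 => M j i) sT;
  rewrite !mxE.
have T0 i : T i i = 0.
  have /eqP := sk i i; rewrite -addr_eq0 -mulr2n -mulr_natr mulf_eq0 pnatr_eq0 orbF.
  by move/eqP.
pose m : 'rV[R]_3 := \row_k nth 0 [:: (- T (inord 1) (inord 2)); (T (inord 0) (inord
  2)); (- T (inord 0) (inord 1))] k.
exists (row_mx m (- (m *m p^T))); split.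
  rewrite /hlin tr_row_mx mul_row_col mul1mx linearN /= trmx_mul trmxK subrr mxE //.
have mE k : m 0 k = nth 0 [:: (- T (inord 1) (inord 2)); (T (inord 0) (inord 2)); (-
  T (inord 0) (inord 1))] k.
  by rewrite mxE.
have mp : (- (m *m p^T)) 0 0 = - (m 0 (inord 0) * p 0 (inord 0) + m 0 (inord 1) * p 0
  (inord 1)
   + m 0 (inord 2) * p 0 (inord 2)).
  by rewrite mxE [(m *m p^T) 0 0]mxE sum_ord3 ![p^T _ _]mxE.
have pE j l : pencil_mx p j l = pt p 0 (pl_i l) * dir (delta_mx 0 j) 0 (pl_j l)
    - pt p 0 (pl_j l) * dir (delta_mx 0 j) 0 (pl_i l).
  by rewrite mxE; rewrite [LHS]mxE.
have cE (L : 'rV[R]_4) l b : contraction_mx L l b =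
    L 0 (pl_i l) *+ (b == pl_j l :> nat) - L 0 (pl_j l) *+ (b == pl_i l :> nat).
  by rewrite mxE.
have dE a b : (a < 3)%N -> (b < 3)%N ->
    (delta_mx 0 (inord a) : 'rV[R]_3) 0 (inord b) = (b == a)%:R.
  by move=> a3 b3; rewrite mxE /= -val_eqE /= !inordK.
have oE a b : (a < 3)%N -> (b < 3)%N ->
    (1%:M : 'M[R]_3) (inord a) (inord b) = (a == b)%:R.
  by move=> a3 b3; rewrite mxE -val_eqE /= !inordK.
have o1 : (1 : 'M[R]_1) 0 0 = 1 by rewrite mxE.
have z1 : (0 : 'M[R]_1) 0 0 = 0 by rewrite mxE.
have nE b : (- p) 0 b = - p 0 b by rewrite mxE.
apply/matrixP => a k; rewrite mul_klein [(T *m _) _ _]mxE sum_ord3 !pE.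
rewrite [RHS]mxE [RHS]mxE sum_ord4 !cE !pl_iE !pl_jE /pl_i /pl_j.
rewrite -[a]inord_val.
case: k => [[|[|[|[|[|[|//]]]]]] ?]; rewrite /= !row_mx_inord ?col_mx_inord //
  !inordK //= ?mp ?mE ?inordK //=.
all: case: a => [[|[|[|//]]] ?] /=; rewrite !(dE, oE) //= ?T0 ?(sk (inord 1) (inord 0))
  ?(sk (inord 2) (inord 0)) ?(sk (inord 2) (inord 1)) ?o1 ?z1 ?nE ?mulr0n ?mulr1n
    ?expr0 ?expr1; ring.
Qed.

End LinesThroughPoint.

(** * Quadratic complexes with Segre symbol [(222)] *)

Section SegreSymbol.
Variable R : realType.
Implicit Types (L : 'rV[R]_(3 + 1)) (p : 'rV[R]_3) (C : 'M[R]_6).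

Lemma contraction_mxD (L M : 'rV[R]_4) :
  contraction_mx (L + M) = contraction_mx L + contraction_mx M.
Proof. by apply/matrixP => k l; rewrite !mxE !mulrnDl; ring. Qed.

Local Notation chart p := (col_mx 1%:M (- p) : 'M[R]_(3 + 1, 3)).

Lemma contraction_chart_pencil L p :
  (contraction_mx L *m chart p)^T *m (pencil_mx p)^T = (hlin L p)%:M.
Proof.
rewrite -trmx_mul mulmxA pencil_contraction hyperplane_proj_chart.
by rewrite tr_scalar_mx.
Qed.

Lemma contraction_chart_isotropic L p :
  (contraction_mx L *m chart p)^T *m klein *m (contraction_mx L *m chart p) = 0.
Proof.
rewrite trmx_mul !mulmxA -(mulmxA (chart p)^T) -(mulmxA (chart p)^T).
by rewrite contraction_klein mulmx0 mul0mx.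
Qed.

(* Among the isotropic complements of the pencil of lines through p, those
   of the form L /\ V are parametrized by L with L(p) = 1, and the others
   differ from them by a skew 3 x 3 matrix, hence by another such L. *)
Lemma isotropic_complement p (Z : 'M[R]_(3, 6)) :
  Z *m (pencil_mx p)^T = 1%:M -> Z *m klein *m Z^T = 0 ->
  exists L, hlin L p = 1 /\ Z^T = contraction_mx L *m chart p.
Proof.
move=> ZS ZZ; set S := pencil_mx p in ZS *.
(* The hyperplane at infinity, with value 1 at every (p, 1), gives a reference complement Z0. *)
pose L0 : 'rV[R]_(3 + 1) := row_mx 0 1.
have hL0 : hlin L0 p = 1.
  by rewrite /hlin tr_row_mx mul_row_col trmx0 mulmx0 add0r mul1mx trmx1 mxE.
pose Z0 := (contraction_mx L0 *m chart p)^T.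
have Z0S : Z0 *m S^T = 1%:M by rewrite contraction_chart_pencil hL0.
have Z0Z0 : Z0 *m klein *m Z0^T = 0 by rewrite [Z0^T]trmxK contraction_chart_isotropic.
have SS : S *m klein *m S^T = 0 := pencil_klein p.
have KK := klein_sqr R.
have KT := klein_tr R.
have SZ0 : S *m Z0^T = 1%:M by rewrite -[S]trmxK -trmx_mul Z0S trmx1.
(* The rows of Z0 and S klein form a basis whose dual basis is given by the columns of S^T and klein
   Z0^T. *)
have dec : S^T *m Z0 + klein *m Z0^T *m S *m klein = 1%:M.
  have : col_mx Z0 (S *m klein) *m row_mx S^T (klein *m Z0^T) = (1%:M : 'M[R]_(3 + 3)).
    rewrite mul_col_row Z0S SS !mulmxA Z0Z0 -(mulmxA S) KK mulmx1 SZ0.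
    by rewrite -scalar_mx_block.
  by move/mulmx1C; rewrite mul_row_col !mulmxA.
have [D ZE] : exists D, Z = Z0 + D by exists (Z - Z0); rewrite addrC subrK.
have DS : D *m S^T = 0.
  by move: ZS; rewrite ZE mulmxDl Z0S -[RHS]addr0 => /addrI.
(* D kills S^T, so its rows are combinations of those of S klein, with coefficients T. Expanding Z
   klein Z^T = 0 then leaves T + T^T = 0. *)
pose T := D *m klein *m Z0^T.
have DE : D = T *m S *m klein.
  by rewrite -[LHS]mulmx1 -dec mulmxDr mulmxA DS mul0mx add0r !mulmxA.
have sT : T^T = - T.
  have DD : D *m klein *m D^T = 0.
    by rewrite {2}DE (trmx_mul (T *m S)) (trmx_mul T S) KT !mulmxA -(mulmxA D) KK
      mulmx1 DS mul0mx.
  have TT : T^T = Z0 *m klein *m D^T by rewrite /T !trmx_mul trmxK KT mulmxA.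
  apply/eqP; rewrite -addr_eq0 TT; apply/eqP.
  have ZET : Z^T = Z0^T + D^T by rewrite ZE linearD.
  by rewrite -ZZ ZET ZE !(mulmxDl, mulmxDr) Z0Z0 DD add0r addr0 addrC.
have [M [hM TM]] := skew_contraction p sT.
exists (L0 + M); split.
  by move: hL0 hM; rewrite /hlin linearD /= mulmxDr mulmx_entryD => -> ->; rewrite
    addr0.
by rewrite ZE DE TM linearD /= !trmxK contraction_mxD mulmxDl.
Qed.

(** Subtracting mu klein leaves the restriction G to the lines through p unchanged and gives C' of
    rank 3 with isotropic row space. As G is invertible, S C' spans that row space, and C' = Z^T G Z
    with Z = G^-1 S C' isotropic and dual to S; [isotropic_complement] then yields L. *)
Lemma segre_222_contraction C p : segre_222 C ->
  \det (pencil_mx p *m C *m (pencil_mx p)^T) != 0 ->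
  exists L Q mu, hlin L p != 0 /\
    C = contraction_mx L *m Q *m (contraction_mx L)^T + mu *: klein.
Proof.
move=> [sC [mu /=]]; set N := _ - _ => -[NN rN] dG.
set S := pencil_mx p in dG *.
have KK := klein_sqr R; have KT := klein_tr R.
pose C' := C - mu *: klein.
have NE : N = klein *m C'.
  by rewrite /N mulmxBr -scalemxAr KK scalemx1.
have CE : C' = klein *m N by rewrite NE mulmxA KK mul1mx.
have CKC : C' *m klein *m C' = 0.
  by rewrite -mulmxA -NE CE -mulmxA NN mulmx0.
have sC' : C'^T = C' by rewrite linearB linearZ /= sC KT.
have uK : (klein : 'M[R]_6) \in unitmx by case: (mulmx1_unit KK).
have rC' : \rank C' = 3%N.
  by rewrite CE (eqmxMfull N _) // row_full_unit.
pose G := S *m C' *m S^T.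
have GE : G = S *m C *m S^T.
  by rewrite /G mulmxBr mulmxBl -scalemxAr -scalemxAl pencil_klein scaler0 subr0.
have uG : G \in unitmx by rewrite unitmxE unitfE GE.
have sG : G^T = G by rewrite /G !trmx_mul trmxK sC' mulmxA.
pose Y := S *m C'.
have YT : Y^T = C' *m S^T by rewrite trmx_mul sC'.
have rY : \rank Y = 3%N.
  apply/eqP; rewrite eqn_leq rank_leq_row /=.
  by have := mxrankM_maxl Y S^T; rewrite -/G (mxrank_unit uG).
have [W WE] : exists W, C' = W *m Y.
  apply/submxP; have : (Y <= C')%MS by exact: submxMl.
  by move=> YC; rewrite -(geq_leqif (mxrank_leqif_sup YC)) rY rC'.
have WG : W *m G = Y^T by rewrite YT [in RHS]WE -mulmxA.
have CY : C' = Y^T *m invmx G *m Y by rewrite -WG mulmxK.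
pose Z := invmx G *m Y.
have ZS : Z *m S^T = 1%:M by rewrite -mulmxA -/G mulVmx.
have ZT : Z^T = Y^T *m invmx G by rewrite trmx_mul trmx_inv sG.
have ZZ : Z *m klein *m Z^T = 0.
  rewrite ZT YT /Z /Y !mulmxA -(mulmxA _ C' klein) -(mulmxA _ (C' *m klein) C') CKC.
  by rewrite mulmx0 !mul0mx.
have [L [hL ZL]] := isotropic_complement ZS ZZ.
exists L, (chart p *m G *m (chart p)^T), mu; split; first by rewrite hL oner_eq0.
have CZ : C' = Z^T *m G *m Z.
  by rewrite ZT /Z -(mulmxA _ (invmx G) G) mulVmx // mulmx1 mulmxA.
have -> : C = C' + mu *: klein by rewrite subrK.
have ZE : Z = (contraction_mx L *m chart p)^T by rewrite -ZL trmxK.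
by rewrite CZ ZL ZE trmx_mul !mulmxA.
Qed.

(** The eigenvalue is 0: the square vanishes by [contraction_klein], the rank is at most 3 because
    the contraction kills L^T, and at least 3 because the restriction to the lines through p is
    invertible. *)
Lemma segre_222_of_contraction L (Q : 'M[R]_(3 + 1)) p : Q^T = Q ->
  \det (hyperplane_proj L p *m Q *m (hyperplane_proj L p)^T) != 0 ->
  segre_222 (contraction_mx L *m Q *m (contraction_mx L)^T).
Proof.
move=> sQ dT; set B := contraction_mx L; set C := B *m Q *m B^T.
have KK := klein_sqr R.
split; first by rewrite /C !trmx_mul trmxK sQ mulmxA.
exists 0; rewrite /= raddf0 subr0; split.
  rewrite /C !mulmxA -(mulmxA _ B^T klein) -(mulmxA _ (B^T *m klein) B).
  by rewrite contraction_klein mulmx0 !mul0mx.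
have uK : (klein : 'M[R]_6) \in unitmx by case: (mulmx1_unit KK).
have -> : \rank (klein *m C) = \rank C by rewrite (eqmxMfull C _) // row_full_unit.
apply/eqP; rewrite eqn_leq; apply/andP; split.
  have L0 : L != 0.
    apply: contraNneq dT => ->; rewrite /hyperplane_proj trmx0 mulmx0 linear0 trmx0.
    by rewrite mul0mx mxE scale0r subr0 !mul0mx det0.
  have rB : (\rank B <= 3)%N.
    have := mulmx0_rank_max (contraction_mx_ker L).
    by rewrite mxrank_tr rank_rV L0 addn1 ltnS.
  apply: leq_trans rB; rewrite /C -mulmxA; exact: mxrankM_maxl.
have E : pencil_mx p *m C *m (pencil_mx p)^T = hyperplane_proj L p *m Q *m
  (hyperplane_proj L p)^T.
  by rewrite -pencil_contraction -/B trmx_mul /C !mulmxA.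
have u : pencil_mx p *m C *m (pencil_mx p)^T \in unitmx by rewrite unitmxE unitfE E.
have := leq_trans (mxrankM_maxl (pencil_mx p *m C) (pencil_mx p)^T) (mxrankM_maxr _ _).
by rewrite (mxrank_unit u).
Qed.

End SegreSymbol.

(** * Null lines in three-dimensional projective space as a quadratic complex *)

Section NullComplex.
Variable R : realType.
Implicit Types (U : set 'rV[R]_3) (F : 'rV[R]_3 -> 'M[R]_3).

Lemma cqf_plucker (C : 'M[R]_6) (p : 'rV[R]_3) (v : 'rV[R[i]]_3) :
  cqf C (plucker (hpt p) (hdir v)) = cqf (pencil_mx p *m C *m (pencil_mx p)^T) v.
Proof. by rewrite plucker_pencil cqf_mulmx. Qed.

(** A point of U supplies the nondegeneracy behind rank 3; Q is symmetrized because [segre_222] asks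
    for a symmetric matrix. *)
Lemma null_quadratic_complex_of_cones U F : U !=set0 ->
  (forall p, U p -> (F p)^T = F p /\ \det (F p) != 0) ->
  null_cones_over_quadric U F -> null_quadratic_complex_222 U F.
Proof.
move=> [p0 Up0] hF [L [Q [L0 h]]].
have key p : U p -> exists2 mu, mu != 0 &
    2 *: F p = mu *: (hyperplane_proj L p *m (Q + Q^T) *m (hyperplane_proj L p)^T).
  move=> Up; have [sF dF] := hF p Up; have [_ [mu eF]] := h p Up; exists mu.
    by apply: contraNneq dF => mu0; rewrite eF mu0 scale0r det0.
  rewrite scaler_nat mulr2n -{2}sF eF linearZ /= -scalerDr; congr (_ *: _).
  by rewrite mulmxDr mulmxDl !trmx_mul trmxK mulmxA.
exists (contraction_mx L *m (Q + Q^T) *m (contraction_mx L)^T); split.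
  apply: (@segre_222_of_contraction _ _ _ p0); first by rewrite linearD /= trmxK addrC.
  have [mu mu0 e] := key p0 Up0; apply: contraNneq (hF p0 Up0).2 => d0.
  have : \det (2 *: F p0) = 0 by rewrite e detZ d0 mulr0.
  by move/eqP; rewrite detZ mulf_eq0 expf_eq0 pnatr_eq0.
move=> p Up v; have [mu mu0 e] := key p Up.
have cx0 (x : R) : (cx x == 0) = (x == 0) by apply/eqP/eqP => [[]|->].
have ev : cx 2 * cqf (F p) v = cx mu *
    cqf (hyperplane_proj L p *m (Q + Q^T) *m (hyperplane_proj L p)^T) v.
  by rewrite -!cqfZ e.
rewrite cqf_plucker /null_dir.
have -> : pencil_mx p *m (contraction_mx L *m (Q + Q^T) *m (contraction_mx L)^T) *m
  (pencil_mx p)^T =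
    hyperplane_proj L p *m (Q + Q^T) *m (hyperplane_proj L p)^T.
  by rewrite -pencil_contraction trmx_mul !mulmxA.
split=> [F0|q0].
  move/eqP: ev; rewrite F0 mulr0 eq_sym mulf_eq0 cx0 (negPf mu0) /=.
  by move/eqP.
move/eqP: ev; rewrite q0 mulr0 mulf_eq0 cx0 pnatr_eq0 /=.
by move/eqP.
Qed.

Lemma null_quadratic_complex_222P U F :
  (forall p, U p -> (F p)^T = F p /\ \det (F p) != 0) ->
  null_cones_over_quadric U F <-> null_quadratic_complex_222 U F.
Proof.
move=> hF; split=> [h|[C [sC hC]]].
  have [U0|/set0P Un0] := eqVneq U set0; last exact: null_quadratic_complex_of_cones.
  (* For empty U some complex with symbol [(222)] must still be exhibited; it is taken from the
     constant form 1 on the whole space, linearizable by the identity. *)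
  have h1 (p : 'rV[R]_3) : [set: 'rV[R]_3] p -> ((1%:M : 'M[R]_3)^T = 1%:M) /\ \det
    (1%:M : 'M[R]_3) != 0.
    by rewrite trmx1 det1 oner_eq0.
  have ne : [set: 'rV[R]_3] !=set0 by exists 0.
  have [|C [sC _]] := @null_quadratic_complex_of_cones setT (fun=> 1%:M) ne h1.
    have [lc _] := @linearizable_coneP R 3 setT (fun=> 1%:M) isT h1; apply: lc.
    exists 1%:M; split; first by rewrite det1.
    exists 1%:M => p _ /=.
    have -> : ulsubmx (1%:M : 'M[R]_(3 + 1)) + ursubmx (1%:M : 'M[R]_(3 + 1)) *m p =
      1%:M.
      by rewrite scalar_mx_block block_mxKul block_mxKur mul0mx addr0.
    split; first by rewrite det1 oner_eq0.
    by exists 1; rewrite det1 !mul1mx trmx1.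
  by exists C; split=> // p; rewrite U0.
have [U0|/set0P[p0 Up0]] := eqVneq U set0.
  exists (const_mx 1), 0; split; last by move=> p; rewrite U0.
  by apply/eqP => /matrixP/(_ 0 0); rewrite !mxE => /eqP; rewrite oner_eq0.
have F_neq0 p : U p -> F p != 0.
  by move=> /hF[_]; apply: contraNneq => ->; rewrite det0.
have key p : U p -> exists c, F p = c *: (pencil_mx p *m C *m (pencil_mx p)^T).
  move=> Up; have [|c eF] := @proportional_of_same_null_cone R 3 (F p)
      (pencil_mx p *m C *m (pencil_mx p)^T) (hF p Up).1 (F_neq0 p Up).
    by move=> v; rewrite -cqf_plucker; exact: hC.
  exists (c *+ 2); rewrite eF !trmx_mul trmxK sC.1 mulmxA -mulr2n.
  by rewrite -scalerMnr scalerMnl.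
(* L and Q are found at the single point p0 but serve at every p, since C is constant and its klein
   term vanishes on the lines through p. *)
have [|L [Q [mu [hL eC]]]] := @segre_222_contraction R C p0 sC.
  have [c e] := key p0 Up0; apply: contraNneq (hF p0 Up0).2 => d0.
  by rewrite e detZ d0 mulr0.
have conj p : pencil_mx p *m C *m (pencil_mx p)^T =
    hyperplane_proj L p *m Q *m (hyperplane_proj L p)^T.
  rewrite eC mulmxDr mulmxDl -scalemxAr -scalemxAl pencil_klein scaler0 addr0.
  by rewrite -pencil_contraction trmx_mul !mulmxA.
exists L, Q; split.
  by apply: contraNneq hL => ->; rewrite /hlin trmx0 mulmx0 mxE.
move=> p Up; have [c e] := key p Up; rewrite conj in e; split; last by exists c.
(* Where L(P) = 0, [hyperplane_proj L p] has rank at most 1, which is incompatible with an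
   invertible F(p) of size 3. *)
apply: contraNneq (hF p Up).2 => l0.
have uF : F p \notin unitmx; last by rewrite unitmxE unitfE negbK in uF.
apply/negP => uF.
have : (\rank (F p) <= 1)%N.
  rewrite e; apply: leq_trans (mxrank_scale _ _) _.
  rewrite -mulmxA; apply: leq_trans (mxrankM_maxl _ _) _.
  rewrite /hyperplane_proj l0 scale0r sub0r mxrank_opp.
  by apply: leq_trans (mxrankM_maxl _ _) (rank_leq_col _).
by rewrite (mxrank_unit uF).
Qed.

End NullComplex.

Theorem theorem4 (R : realType) :
  (forall (n : nat) (U : set 'rV[R]_n) (F : 'rV[R]_n -> 'M[R]_n),
     (2 <= n)%N -> open U ->
     (forall p, U p -> (F p)^T = F p /\ \det (F p) != 0) ->
     (linearizable U F <-> lagrangian_QL U F) /\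
     (linearizable U F <-> null_complex_through_quadric U F)) /\
  (forall (U : set 'rV[R]_3) (F : 'rV[R]_3 -> 'M[R]_3),
     open U ->
     (forall p, U p -> (F p)^T = F p /\ \det (F p) != 0) ->
     (linearizable U F <-> null_quadratic_complex_222 U F)).
Proof.
split=> [n U F n2 oU hF|U F oU hF].
  have n_gt0 : (0 < n)%N by exact: ltn_trans n2.
  have lin := linearizable_coneP n_gt0 hF.
  split; first exact: iff_trans lin (iff_sym (lagrangian_coneP n_gt0 oU hF)).
  exact: iff_trans lin (null_complex_through_quadricP n_gt0 hF).
have lin := @linearizable_coneP R 3 U F isT hF.
exact: iff_trans lin (null_quadratic_complex_222P hF).
Qed.
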